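(* Let $(\mathfrak g,[\ ,\ ],\{\ ,\ ,\ \})$ be a (finite-dimensional, real) Lie-Yamaguti algebra equipped with a smooth action of a Lie group $G$. Let $M$ be a smooth manifold with a given countable atlas $\{U_i : i\in I\}$ together with a family of smooth transition maps $g_{ij}:U_i\cap U_j\to G$, $i,j\in I$, in $M$ with values in $G$. Then there exists a locally trivial Lie-Yamaguti algebra bundle over $M$ with fibre $\mathfrak g$, with $G$ as the structure group of the bundle, and with $\{g_{ij}\}$ as the associated transition maps.
   Context: All manifolds (Hausdorff, second countable), vector bundles and maps are smooth, and the ground field is $\mathbb R$. Lie-Yamaguti algebra: a vector space $\mathfrak g$ with a bilinear operation $[\ ,\ ]$ and a trilinear operation $\{\ ,\ ,\ \}$ on $\mathfrak g$ such that for all $x,y,z,u,v,w\in\mathfrak g$: (LY1) $[x,y]=-[y,x]$; (LY2) $\{x,y,z\}=-\{y,x,z\}$; (LY3) $\sum_{\circlearrowleft(x,y,z)}([[x,y],z]+\{x,y,z\})=0$; (LY4) $\sum_{\circlearrowleft(x,y,z)}\{[x,y],z,u\}=0$; (LY5) $\{x,y,[u,v]\}=[\{x,y,u\},v]+[u,\{x,y,v\}]$; (LY6) $\{x,y,\{u,v,w\}\}=\{\{x,y,u\},v,w\}+\{u,\{x,y,v\},w\}+\{u,v,\{x,y,w\}\}$, where $\sum_{\circlearrowleft(x,y,z)}$ is the sum over cyclic permutations of $x,y,z$. A homomorphism is a linear map preserving both operations; an isomorphism is a homomorphism with an inverse homomorphism; $\mathrm{Aut}_{\mathrm{LYA}}(\mathfrak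 g)$ is the group of self-isomorphisms of $\mathfrak g$. A (smooth) action of a Lie group $G$ on $\mathfrak g$ is a smooth group homomorphism $\phi:G\to\mathrm{Aut}_{\mathrm{LYA}}(\mathfrak g)$; write $ga=\phi_g(a)$. A family of smooth transition maps in $M$ with values in $G$ is an atlas $\{U_i:i\in I\}$ of $M$ ($I$ countable; the $U_i$ are the open chart domains, covering $M$) together with smooth maps $g_{ij}:U_i\cap U_j\to G$ such that, for all $i,j,k\in I$ with $U_i\cap U_j\cap U_k\neq\emptyset$, $g_{ij}(m)\,g_{jk}(m)=g_{ik}(m)$ for all $m\in U_i\cap U_j\cap U_k$. For a vector bundle $\xi=(L,p,M)$ (projection $p:L\to M$, fibres $\xi_m$), a $k$-field of brackets is a smooth section of $\mathrm{Hom}(\xi^{\otimes k},\xi)$, i.e. a smooth assignment to $m\in M$ of a $k$-linear operation $\xi_m\times\cdots\times\xi_m\to\xi_m$. A locally trivial Lie-Yamaguti algebra bundle with fibre $\mathfrak g$ is a vector bundle $\xi=(L,p,M)$ with a 2-field $m\mapsto[\ ,\ ]_m$ and a 3-field $m\mapsto\{\ ,\ ,\ \}_m$ of brackets such that $M$ has an open covering $\{U_i\}$ with local trivializations $\psi_i:U_i\times\mathfrak g\to p^{-1}(U_i)$ for which each $\psi_{i,m}=\psi_i(m,\cdot):\mathfrak g\to\xi_m$, $m\in U_i$, is a Lie-Yamaguti algebra isomorphism. (In particular each fibre $\xi_m$ is a Lie-Yamaguti algebra.) That $G$ is the structure group and $\{g_{ij}\}$ are the associated transition maps means that such local trivializations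 $\psi_i$ exist over the given $U_i$, $i\in I$, with $\psi_{i,m}^{-1}\circ\psi_{j,m}(a)=g_{ij}(m)a$ for all $m\in U_i\cap U_j$, $a\in\mathfrak g$. *)

(* Defs.v *)
From HB Require Import structures.
From mathcomp Require Import all_boot all_order all_algebra.
From mathcomp Require Import all_classical all_reals all_analysis.
Set Implicit Arguments.
Unset Strict Implicit.
Unset Printing Implicit Defensive.
Import Order.TTheory GRing.Theory Num.Theory numFieldNormedType.Exports.
Local Open Scope classical_set_scope.
Local Open Scope ring_scope.

Section Smooth.
Context {R : realType} {V W : normedModType R}.

(* For finite-dimensional V this is the usual notion of class C^k: f is C^k.+1
   iff it is differentiable and all its directional derivatives are C^k. *)
Fixpoint Ck_on (k : nat) (U : set V) (f : V -> W) : Prop :=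
  match k with
  | 0%N => forall x, U x -> {for x, continuous f}
  | k.+1 => (forall x, U x -> differentiable f x) /\
            (forall v, Ck_on k U (fun x => 'D_v f x))
  end.

Definition smooth_on (U : set V) (f : V -> W) := forall k, Ck_on k U f.

End Smooth.

(* [cmap] is only meaningful on [cdom]. *)
Record chart (R : realType) (n : nat) (T : Type) := Chart {
  cdom : set T;
  cmap :> T -> 'rV[R]_n }.

Section Charts.
Context {R : realType}.

(* The map h \o (c|A)^-1, extended by 0 outside c(A). *)
Definition in_coords {n m} {T : Type} (c : chart R n T) (A : set T)
    (h : T -> 'rV[R]_m) : 'rV[R]_n -> 'rV[R]_m :=
  fun y => xget 0 [set h x | x in A `&` c @^-1` [set y]].

(* A homeomorphism from an open set onto an open subset of R^n. *)
Definition is_chart {n} {T : topologicalType} (c : chart R n T) :=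
  [/\ open (cdom c),
      {in cdom c &, injective c},
      forall x, cdom c x -> {for x, continuous c} &
      forall A, open A -> A `<=` cdom c -> open (c @` A)].

Definition compatible {n} {T : Type} (c e : chart R n T) :=
  let A := cdom c `&` cdom e in
  smooth_on (c @` A) (in_coords c A e) /\ smooth_on (e @` A) (in_coords e A c).

Definition smooth_map {n m} {X Y : topologicalType}
    (A : set (chart R n X)) (B : set (chart R m Y)) (D : set X) (f : X -> Y) :=
  (forall x, D x -> {for x, continuous f}) /\
  (forall c e, A c -> B e ->
     let W := cdom c `&` D `&` f @^-1` cdom e in
     smooth_on (c @` W) (in_coords c W (e \o f))).

Definition diffeomorphism {n m} {X Y : topologicalType}
    (A : set (chart R n X)) (B : set (chart R m Y))
    (D : set X) (E : set Y) (f : X -> Y) :=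
  smooth_map A B D f /\
  exists f' : Y -> X,
    [/\ smooth_map B A E f', {homo f : x / D x >-> E x},
        {homo f' : y / E y >-> D y},
        {in D, cancel f f'} & {in E, cancel f' f}].

Definition euclidean_atlas (n : nat) : set (chart R n 'rV[R]_n) :=
  [set Chart setT id].

Definition prod_chart {n m} {X Y : Type} (c : chart R n X) (e : chart R m Y) :
    chart R (n + m) (X * Y) :=
  Chart (cdom c `*` cdom e) (fun p => row_mx (c p.1) (e p.2)).

Definition prod_atlas {n m} {X Y : Type}
    (A : set (chart R n X)) (B : set (chart R m Y)) :
    set (chart R (n + m) (X * Y)) :=
  [set prod_chart c e | c in A & e in B].

End Charts.
Arguments euclidean_atlas R n : clear implicits.

Record smooth_structure (R : realType) (n : nat) (T : topologicalType) :=
  SmoothStructure {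
    charts :> set (chart R n T);
    charts_hausdorff : hausdorff_space T;
    charts_second_countable : @second_countable T;
    charts_cover : forall x, exists2 c, charts c & cdom c x;
    charts_chart : forall c, charts c -> is_chart c;
    charts_compatible : forall c e, charts c -> charts e -> compatible c e }.

Record manifold (R : realType) (n : nat) := Manifold {
  manifold_space :> topologicalType;
  atlas : smooth_structure R n manifold_space }.

(* A chart in the maximal atlas of M. *)
Definition admissible (R : realType) (n : nat) (M : manifold R n)
    (c : chart R n M) :=
  is_chart c /\ forall e, charts (atlas M) e -> compatible c e.

#[short(type="groupTopologicalType")]
HB.structure Definition GroupTopological := {G of Group G & Topological G}.

Record lie_group (R : realType) (k : nat) := LieGroup {
  lie_carrier :> groupTopologicalType;
  lie_atlas : smooth_structure R k lie_carrier;
  lie_mul_smooth : smooth_map (prod_atlas lie_atlas lie_atlas) lie_atlas setT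
                     (fun p : lie_carrier * lie_carrier => (p.1 * p.2)%g);
  lie_inv_smooth : smooth_map lie_atlas lie_atlas setT
                     (fun x : lie_carrier => (x^-1)%g) }.

Record ly_brackets (V : Type) := LYBrackets {
  lbr : V -> V -> V;
  tbr : V -> V -> V -> V }.

Section LieYamaguti.
Context {R : realType}.

Definition bilinear_op {V : lmodType R} (b : V -> V -> V) :=
  (forall y, linear (b ^~ y)) /\ (forall x, linear (b x)).

Definition trilinear_op {V : lmodType R} (t : V -> V -> V -> V) :=
  [/\ forall y z, linear (fun x => t x y z),
      forall x z, linear (fun y => t x y z) &
      forall x y, linear (fun z => t x y z)].

Record lie_yamaguti {V : lmodType R} (B : ly_brackets V) : Prop := LieYamaguti {
  ly_bilinear : bilinear_op (lbr B);
  ly_trilinear : trilinear_op (tbr B);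
  ly1 : forall x y, lbr B x y = - lbr B y x;
  ly2 : forall x y z, tbr B x y z = - tbr B y x z;
  ly3 : forall x y z,
    (lbr B (lbr B x y) z + tbr B x y z) + (lbr B (lbr B y z) x + tbr B y z x) +
    (lbr B (lbr B z x) y + tbr B z x y) = 0;
  ly4 : forall x y z u,
    tbr B (lbr B x y) z u + tbr B (lbr B y z) x u + tbr B (lbr B z x) y u = 0;
  ly5 : forall x y u v,
    tbr B x y (lbr B u v) = lbr B (tbr B x y u) v + lbr B u (tbr B x y v);
  ly6 : forall x y u v w,
    tbr B x y (tbr B u v w) =
    tbr B (tbr B x y u) v w + tbr B u (tbr B x y v) w + tbr B u v (tbr B x y w) }.

Definition ly_hom {V W : lmodType R} (B : ly_brackets V) (C : ly_brackets W)
    (f : V -> W) :=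
  [/\ linear f,
      forall x y, f (lbr B x y) = lbr C (f x) (f y) &
      forall x y z, f (tbr B x y z) = tbr C (f x) (f y) (f z)].

Definition ly_iso {V W : lmodType R} (B : ly_brackets V) (C : ly_brackets W)
    (f : V -> W) :=
  ly_hom B C f /\
  exists f' : W -> V, [/\ ly_hom C B f', cancel f f' & cancel f' f].

(* Coordinates of a finite-dimensional space; they define its topology and
   smooth structure, which do not depend on the basis chosen. *)
Definition vcoords {F : vectType R} : F -> 'rV[R]_(\dim {:F}) :=
  passmx.rVof (vbasis {:F}).

Definition vfrom {F : vectType R} : 'rV[R]_(\dim {:F}) -> F :=
  passmx.vecof (vbasis {:F}).

Definition end_matrix {F : vectType R} (f : F -> F) : 'M[R]_(\dim {:F}) :=
  lin1_mx (vcoords \o f \o vfrom).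

(* Aut(g) is a closed subgroup of GL(g), so a map into it is smooth iff the
   matrix of its value is smooth. *)
Definition smooth_action {F : vectType R} (B : ly_brackets F) {k : nat}
    (G : lie_group R k) (phi : G -> F -> F) :=
  [/\ forall g, ly_iso B B (phi g),
      forall g h a, phi (g * h)%g a = phi g (phi h a) &
      smooth_map (lie_atlas G) (euclidean_atlas R _) setT
        (fun g => mxvec (end_matrix (phi g)))].

End LieYamaguti.

(* [fibre m] is a vector space identified with the set p^-1(m) by [fincl m]. *)
Record bundle_data (R : realType) (n r : nat) (M : manifold R n) := BundleData {
  total : manifold R (n + r);
  proj : total -> M;
  fibre : M -> lmodType R;
  fincl : forall m, fibre m -> total;
  fincl_inj : forall m, injective (@fincl m);
  fincl_range : forall m, range (@fincl m) = proj @^-1` [set m] }.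
Arguments proj {R n r M} b x.

(* psi : U x F -> p^-1(U), where psi_m = lt_fun m and its inverse lt_inv m are
   only meaningful for m in U = lt_dom. F enters through its coordinates. *)
Record local_triv (R : realType) (n r : nat) (M : manifold R n)
    (xi : bundle_data r M) (F : vectType R) := LocalTriv {
  lt_dom : set M;
  lt_fun : forall m, F -> fibre xi m;
  lt_inv : forall m, fibre xi m -> F;
  lt_open : open lt_dom;
  lt_linear : forall m, lt_dom m -> linear (lt_fun m);
  lt_funK : forall m, lt_dom m -> cancel (lt_fun m) (@lt_inv m);
  lt_invK : forall m, lt_dom m -> cancel (@lt_inv m) (lt_fun m);
  lt_diffeo :
    diffeomorphism
      (prod_atlas (atlas M) (euclidean_atlas R (\dim {:F}))) (atlas (total xi))
      (lt_dom `*` setT) (proj xi @^-1` lt_dom)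
      (fun q => fincl (lt_fun q.1 (vfrom q.2))) }.

Record vector_bundle (R : realType) (n : nat) (M : manifold R n)
    (F : vectType R) := VectorBundle {
  vb_data :> bundle_data (\dim {:F}) M;
  vb_proj_smooth :
    smooth_map (atlas (total vb_data)) (atlas M) setT (proj vb_data);
  vb_locally_trivial :
    forall m, exists t : local_triv vb_data F, lt_dom t m }.

Section Bundles.
Context {R : realType} {n : nat} {M : manifold R n} {F : vectType R}.

(* A smooth section of Hom(xi (x) xi, xi): in each of the local trivializations
   of that bundle induced by those of xi, its coefficients are smooth. *)
Definition field2 (xi : vector_bundle M F)
    (b : forall m, fibre xi m -> fibre xi m -> fibre xi m) :=
  (forall m, bilinear_op (b m)) /\
  forall (t : local_triv xi F) (x y : F),
    smooth_map (atlas M) (euclidean_atlas R _) (lt_dom t)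
      (fun m => vcoords (lt_inv t (b m (lt_fun t m x) (lt_fun t m y)))).

Definition field3 (xi : vector_bundle M F)
    (b : forall m, fibre xi m -> fibre xi m -> fibre xi m -> fibre xi m) :=
  (forall m, trilinear_op (b m)) /\
  forall (t : local_triv xi F) (x y z : F),
    smooth_map (atlas M) (euclidean_atlas R _) (lt_dom t)
      (fun m => vcoords
         (lt_inv t (b m (lt_fun t m x) (lt_fun t m y) (lt_fun t m z)))).

Definition ly_local_triv (xi : vector_bundle M F)
    (C : forall m, ly_brackets (fibre xi m)) (B : ly_brackets F)
    (t : local_triv xi F) :=
  forall m, lt_dom t m -> ly_iso B (C m) (lt_fun t m).

Record ly_bundle (B : ly_brackets F) := LYBundle {
  lyb_bundle :> vector_bundle M F;
  lyb_brackets : forall m, ly_brackets (fibre lyb_bundle m);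
  lyb_field2 : field2 (fun m => lbr (lyb_brackets m));
  lyb_field3 : field3 (fun m => tbr (lyb_brackets m));
  lyb_locally_trivial :
    forall m, exists2 t : local_triv lyb_bundle F,
      ly_local_triv lyb_brackets B t & lt_dom t m }.

End Bundles.
Arguments ly_bundle {R n} M {F} B.

Section Transitions.
Context {R : realType} {n k : nat} {M : manifold R n} {I : Type}.

Definition countable_atlas (U : I -> chart R n M) :=
  [/\ countable [set: I], forall i, admissible (U i) &
      forall m, exists i, cdom (U i) m].

(* [g i j] is only meaningful on the intersection of the i-th and j-th chart
   domains. *)
Definition transition_maps (G : lie_group R k) (U : I -> chart R n M)
    (g : I -> I -> M -> G) :=
  (forall i j, smooth_map (atlas M) (lie_atlas G)
                 (cdom (U i) `&` cdom (U j)) (g i j)) /\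
  (forall i j l m, cdom (U i) m -> cdom (U j) m -> cdom (U l) m ->
     (g i j m * g j l m)%g = g i l m).

Definition associated_transitions {F : vectType R} (B : ly_brackets F)
    (G : lie_group R k) (phi : G -> F -> F) (U : I -> chart R n M)
    (g : I -> I -> M -> G) (xi : ly_bundle M B) :=
  exists t : I -> local_triv xi F,
    [/\ forall i, lt_dom (t i) = cdom (U i),
        forall i, ly_local_triv (@lyb_brackets _ _ _ _ _ xi) B (t i) &
        forall i j m a, cdom (U i) m -> cdom (U j) m ->
          lt_inv (t i) (lt_fun (t j) m a) = phi (g i j m) a].

End Transitions.

(* Main.v *)
(** The total space is glued from the products U_i x g without a quotient: pick
for every m an index s(m) with m in U_(s m), and let the pair (m, a) of M x g
stand for the class of (m, a) in the s(m)-th product. The i-th trivialization is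
then (m, v) |-> (m, g_(s(m),i)(m) v), and M x g gets the final topology of these
maps; the cocycle identity turns every change of trivialization into
(m, v) |-> (m, g_ij(m) v), which is smooth. As G acts by Lie-Yamaguti
automorphisms, the constant brackets of g on the fibres are the ones transported
by any of the trivializations. *)

Require Import Defs.
From HB Require Import structures.
From mathcomp Require Import all_boot all_order all_algebra.
From mathcomp Require Import all_classical all_reals all_analysis.
Set Implicit Arguments.
Unset Strict Implicit.
Unset Printing Implicit Defensive.
Import Order.TTheory GRing.Theory Num.Theory numFieldNormedType.Exports.
Local Open Scope classical_set_scope.
Local Open Scope ring_scope.

(** * Calculus of C^k maps *)

(** The choice [s] is arbitrary and in general discontinuous, so the second component of a point of
    M x g has no regularity by itself. Maps into or out of the total space can only be examined
    after composition with some [kappa i] or [psi i], and smoothness enters through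
    [kappa i \o psi j], from which [s] has cancelled. Two obstacles shape the rest. Smoothness is
    defined by [in_coords] on domains that vary with the charts and with the map, which composes
    badly; it is therefore handled through the pointwise relation [smooth_wrt], with [smooth_mapP]
    and [compatibleP] translating to and fro. Moreover [field2] and [field3] ask for smooth brackets
    in every local trivialization of the bundle, not only in the constructed ones. An arbitrary
    trivialization is compared with the i-th one, where by equivariance the brackets have constant
    coefficients and are polynomial in the coordinates. *)

Lemma near_eq_continuous (X Y : topologicalType) (f g : X -> Y) (x : X) :
  {near x, f =1 g} -> {for x, continuous f} -> {for x, continuous g}.
Proof.
move=> fg fx; rewrite /prop_for /continuous_at -(nbhs_singleton fg).
by apply: cvg_trans fx; apply: near_eq_cvg; apply: filterS fg => y ->.
Qed.

Lemma continuous_pair (X Y Z : topologicalType) (f : X -> Y) (h : X -> Z) (x : X) :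
  {for x, continuous f} -> {for x, continuous h} ->
  {for x, continuous (fun y => (f y, h y))}.
Proof. by move=> fx hx; exact: cvg_pair fx hx. Qed.

Section CkCalculus.
Context {R : realType}.
Implicit Types V W Z : normedModType R.

(** The first-order expansion of [f] at [x] only involves its germ, so it is also one for [g];
    uniqueness of the differential does the rest. *)
Lemma near_eq_differentiable V W (f g : V -> W) (x : V) :
  {near x, f =1 g} -> differentiable f x -> differentiable g x.
Proof.
move=> fg df.
suff h : g \o shift x = cst (g x) + 'd f x +o_ (0 : V) id.
  have e : 'd g x = 'd f x :> (V -> W) by apply: diff_unique => //; exact: diff_continuous.
  by apply/diff_locallyP; rewrite e; split => //; exact: diff_continuous.
have fg0 : \forall h \near (0 : V), f (h + x) = g (h + x).
  by have := fg; rewrite (near_shift 0) subr0.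
have /diff_locallyP[_ dfx] := df.
apply/eqaddoP => e e0.
move/eqaddoP/(_ e e0): dfx; apply: filterS2 fg0 => y fgy.
by rewrite /= /GRing.add /= /GRing.opp /= /GRing.add /= fgy (nbhs_singleton fg).
Qed.

(** Derivatives are taken in all of [V], never relative to [U], so every clause of [Ck_on] is a
    condition at a single point. This makes arguments on germs possible. *)
Lemma Ck_on_points V W k (U : set V) (f : V -> W) :
  Ck_on k U f <-> forall x, U x -> Ck_on k [set x] f.
Proof.
elim: k f => [|k IH] f /=; first by split=> [h x Ux _ ->|h x Ux]; [exact: h|exact: (h x)].
split=> [[h1 h2] x Ux|h]; split.
- by move=> _ ->; exact: h1.
- by move=> v; have /IH := h2 v; apply.
- by move=> x Ux; have [h1 _] := h x Ux; exact: h1.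
- by move=> v; apply/IH => x Ux; have [_] := h x Ux.
Qed.

Lemma Ck_on_sub V W k (U U' : set V) (f : V -> W) :
  U' `<=` U -> Ck_on k U f -> Ck_on k U' f.
Proof. by move=> UU' /Ck_on_points h; apply/Ck_on_points => x /UU'; exact: h. Qed.

Lemma Ck_on_near V W k (x : V) (f g : V -> W) :
  {near x, f =1 g} -> Ck_on k [set x] f -> Ck_on k [set x] g.
Proof.
elim: k f g => [|k IH] f g fg /=.
  by move=> h _ ->; apply: near_eq_continuous fg _; exact: h.
move=> [h1 h2]; split=> [_ ->|v]; first by apply: near_eq_differentiable fg _; exact: h1.
apply: IH (h2 v).
(* The maps agree near every point [y] close to [x], hence so do their directional derivatives
   there: equality of germs passes to derivatives. *)
have := near_join fg; apply: filterS => y fgy; exact: near_eq_derive.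
Qed.

Lemma Ck_on_eq V W k (U : set V) (f g : V -> W) :
  open U -> {in U, f =1 g} -> Ck_on k U f -> Ck_on k U g.
Proof.
move=> oU fg /Ck_on_points h; apply/Ck_on_points => x Ux.
apply: Ck_on_near (h _ Ux); near=> y; apply: fg.
by apply/mem_set; near: y; exact: open_nbhs_nbhs.
Unshelve. all: by end_near. Qed.

Lemma Ck_onW V W k (U : set V) (f : V -> W) : Ck_on k.+1 U f -> Ck_on k U f.
Proof.
elim: k f => [|k IH] f [h1 h2].
  by move=> x Ux; apply: differentiable_continuous; exact: h1.
by split=> // v; apply: IH.
Qed.

Lemma Ck_on_cst V W k (U : set V) (a : W) : Ck_on k U (fun=> a).
Proof.
elim: k a => [|k IH] a /=; first by move=> x _; exact: cvg_cst.
split=> [x _|v]; first exact: differentiable_cst.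
suff -> : (fun x => 'D_v (fun=> a) x) = fun=> (0 : W) by [].
by apply/funext => x; exact: derive_cst.
Qed.

Lemma Ck_on_add V W k (U : set V) (f g : V -> W) : open U ->
  Ck_on k U f -> Ck_on k U g -> Ck_on k U (f + g).
Proof.
move=> oU; elim: k f g => [|k IH] f g /=.
  by move=> fx gx x Ux; apply: continuousD; [exact: fx|exact: gx].
move=> [df1 df2] [dg1 dg2]; split=> [x Ux|v].
  by apply: differentiableD; [exact: df1|exact: dg1].
apply: (@Ck_on_eq _ _ _ _ (fun x => 'D_v f x + 'D_v g x)) => //; last exact: IH.
by move=> x /set_mem Ux; rewrite deriveD//; apply: diff_derivable; [exact: df1|exact: dg1].
Qed.

Lemma Ck_on_sum V W (I : Type) (r : seq I) k (U : set V) (f : I -> V -> W) : open U ->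
  (forall i, Ck_on k U (f i)) -> Ck_on k U (fun x => \sum_(i <- r) f i x).
Proof.
move=> oU h; elim: r => [|i r IH].
  by under eq_fun do rewrite big_nil; exact: Ck_on_cst.
by under eq_fun do rewrite big_cons; exact: Ck_on_add.
Qed.

Lemma Ck_on_linear V W Z k (U : set V) (L : {linear W -> Z}) (f : V -> W) : open U ->
  continuous L -> Ck_on k U f -> Ck_on k U (L \o f).
Proof.
move=> oU cL; elim: k f => [|k IH] f /=.
  by move=> fx x Ux; apply: continuous_comp; [exact: fx|exact: cL].
move=> [df1 df2]; split=> [x Ux|v].
  by apply: differentiable_comp; [exact: df1|exact: linear_differentiable].
apply: (@Ck_on_eq _ _ _ _ (L \o (fun x => 'D_v f x))) => //; last exact: IH.
move=> x /set_mem Ux; have dL := linear_differentiable (f x) cL.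
rewrite [RHS]deriveE; last by apply: differentiable_comp => //; exact: df1.
rewrite diff_comp//; last exact: df1.
by rewrite /= diff_lin// deriveE//; exact: df1.
Qed.

Lemma Ck_on_mul V k (U : set V) (f g : V -> R) : open U ->
  Ck_on k U f -> Ck_on k U g -> Ck_on k U (f * g).
Proof.
move=> oU; elim: k f g => [|k IH] f g fk gk.
  by move=> x Ux; apply: continuousM; [exact: fk|exact: gk].
have [[df1 df2] [dg1 dg2]] := (fk, gk); split=> [x Ux|v].
  by apply: differentiableM; [exact: df1|exact: dg1].
apply: (@Ck_on_eq _ _ _ _ (f * (fun x => 'D_v g x) + g * (fun x => 'D_v f x))) => //.
  move=> x /set_mem Ux; rewrite deriveM//; apply: diff_derivable; [exact: df1|exact: dg1].
exact: Ck_on_add (IH _ _ (Ck_onW fk) (dg2 v)) (IH _ _ (Ck_onW gk) (df2 v)).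
Qed.

(** Both directions are instances of [Ck_on_linear]: taking an entry is a continuous linear map, and
    [f] is the sum of its entries times the matrices [delta_mx i j]. *)
Lemma Ck_on_coord V m n k (U : set V) (f : V -> 'M[R]_(m, n)) : open U ->
  Ck_on k U f <-> forall i j, Ck_on k U (fun x => f x i j).
Proof.
move=> oU; split=> [fk i j|fk].
  have lP : scalar (fun N : 'M[R]_(m, n) => N i j) by move=> a u v; rewrite !mxE.
  pose lM := GRing.isLinear.Build _ _ _ _ _ lP.
  pose l : {linear 'M[R]_(m, n) -> R} := HB.pack (fun N : 'M[R]_(m, n) => N i j) lM.
  by apply: (Ck_on_linear (L := l)) fk => //; exact: coord_continuous.
rewrite (_ : f = fun x => \sum_i \sum_j f x i j *: delta_mx i j); last first.
  by apply/funext => x; rewrite [LHS]matrix_sum_delta.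
apply: Ck_on_sum => // i; apply: Ck_on_sum => // j.
pose w : 'M[R]_(m, n) := delta_mx i j.
have lP : linear ( *:%R ^~ w : R -> _) by move=> a u v; rewrite /= scalerDl scalerA.
pose lM := GRing.isLinear.Build _ _ _ _ _ lP.
pose l : {linear R -> 'M[R]_(m, n)} := HB.pack ( *:%R ^~ w) lM.
apply: (Ck_on_linear (L := l)) (fk i j) => //; exact: scalel_continuous.
Qed.

(** The chain rule writes the derivative along [v] as the sum over j of the j-th coordinate of
    ['D_v f] times the j-th partial derivative of [h] composed with [f]. Induction on [k] applies to
    the partial derivatives of [h]; [h] is scalar so that the products fall under [Ck_on_mul]. *)
Lemma Ck_on_comp V m k (U : set V) (U' : set 'rV[R]_m) (f : V -> 'rV[R]_m)
    (h : 'rV[R]_m -> R) : open U -> open U' -> {homo f : x / U x >-> U' x} ->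
  Ck_on k U f -> Ck_on k U' h -> Ck_on k U (h \o f).
Proof.
move=> oU oU' fU; elim: k h => [|k IH] h fk hk.
  by move=> x Ux; apply: continuous_comp; [exact: fk|apply: hk; exact: fU].
have [[df1 df2] [dh1 dh2]] := (fk, hk); split=> [x Ux|v].
  by apply: differentiable_comp; [exact: df1|apply: dh1; exact: fU].
apply: (@Ck_on_eq _ _ _ _ (fun x => \sum_(j < m)
   ('D_v f x 0 j * ('D_(delta_mx 0 j) h \o f) x))) => //.
  move=> x /set_mem Ux; have dh := dh1 _ (fU _ Ux); have df := df1 _ Ux.
  rewrite [RHS]deriveE; last exact: differentiable_comp.
  rewrite diff_comp//= -(deriveE v df) [in RHS](row_sum_delta ('D_v f x)) linear_sum.
  by apply: eq_bigr => j _; rewrite linearZ /= -deriveE.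
apply: Ck_on_sum => // j; apply: Ck_on_mul => //.
  by have /Ck_on_coord := df2 v; apply.
exact: IH (Ck_onW fk) (dh2 _).
Qed.

End CkCalculus.

(** * Smoothness near a point *)

Section SmoothAt.
Context {R : realType}.
Implicit Types V W : normedModType R.

Lemma Ck_on_id V k (U : set V) : Ck_on k U (id : V -> V).
Proof.
case: k => [|k]; first by move=> x _; exact: cvg_id.
split=> [x _|v]; first by case: (is_diff_id x).
suff -> : (fun x : V => 'D_v id x) = fun=> v by exact: Ck_on_cst.
by apply/funext => x; exact: derive_id.
Qed.

(** One neighbourhood serves all orders, and it is open, as the calculus rules for sums, products
    and composites require. *)
Definition smooth_at {V W} (f : V -> W) (x : V) :=
  exists2 D, open_nbhs x D & smooth_on D f.

Lemma smooth_on_at V W (U : set V) (f : V -> W) :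
  (forall x, U x -> smooth_at f x) -> smooth_on U f.
Proof.
move=> h k; apply/Ck_on_points => x Ux; have [D [_ Ox] fO] := h x Ux.
by have /Ck_on_points := fO k; apply.
Qed.

Lemma smooth_at_on V W (U : set V) (f : V -> W) x :
  open U -> smooth_on U f -> U x -> smooth_at f x.
Proof. by move=> oU fU Ux; exists U. Qed.

Lemma near_eq_smooth_at V W (f g : V -> W) x :
  {near x, f =1 g} -> smooth_at f x -> smooth_at g x.
Proof.
move=> fg [D [oO Ox] fO].
have [D' /= [oO' D'x] fgO'] : exists2 D', open_nbhs x D' & D' `<=` [set y | f y = g y].
  by move: fg; rewrite /prop_near1 {1}nbhsE.
exists (D `&` D'); first by split=> //; exact: openI.
move=> k; apply: (@Ck_on_eq _ _ _ _ _ f); first exact: openI.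
  by move=> y /set_mem[_ /fgO'].
by apply: Ck_on_sub (fO k) => y [].
Qed.

Lemma smooth_at_continuous V W (f : V -> W) x :
  smooth_at f x -> {for x, continuous f}.
Proof. by move=> [D [_ Ox] fO]; exact: (fO 0%N). Qed.

Lemma smooth_on_coord V m n (U : set V) (f : V -> 'M[R]_(m, n)) : open U ->
  smooth_on U f <-> forall i j, smooth_on U (fun x => f x i j).
Proof.
move=> oU; split=> [h i j k|h k]; last by apply/Ck_on_coord => // i j; exact: h.
by have /Ck_on_coord := h k; apply.
Qed.

Lemma smooth_at_comp V m n (f : V -> 'rV[R]_m) (h : 'rV[R]_m -> 'rV[R]_n) x :
  smooth_at f x -> smooth_at h (f x) -> smooth_at (h \o f) x.
Proof.
move=> [D [oO Ox] fO] [P [oP Pfx] hP].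
have oOP : open (D `&` f @^-1` P).
  rewrite openE => y [Oy Py]; apply: filterI; first exact: open_nbhs_nbhs.
  by apply: (fO 0%N) => //; exact: open_nbhs_nbhs.
exists (D `&` f @^-1` P) => //.
apply/smooth_on_coord => // i j k.
apply: (@Ck_on_comp _ _ _ _ _ P f (fun z => h z i j)) => // [y []//||].
  by apply: Ck_on_sub (fO k) => y [].
by have /smooth_on_coord := hP; apply.
Qed.

Lemma smooth_at_row_mx V m n (f : V -> 'rV[R]_m) (g : V -> 'rV[R]_n) x :
  smooth_at f x -> smooth_at g x -> smooth_at (fun y => row_mx (f y) (g y)) x.
Proof.
move=> [D [oO Ox] fO] [P [oP Px] gP].
exists (D `&` P); first by split=> //; exact: openI.
apply/smooth_on_coord; first exact: openI.
move=> i j k; rewrite -(fintype.splitK j); case: (fintype.split j) => l /=.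
  under eq_fun do rewrite row_mxEl; apply: (Ck_on_sub (@subIsetl _ D P)).
  by have /smooth_on_coord := fO; apply.
under eq_fun do rewrite row_mxEr; apply: (Ck_on_sub (@subIsetr _ D P)).
by have /smooth_on_coord := gP; apply.
Qed.

Lemma smooth_coord m n i j : smooth_on setT (fun N : 'M[R]_(m, n) => N i j).
Proof.
have : smooth_on setT (id : 'M[R]_(m, n) -> _) by move=> k; exact: Ck_on_id.
by move=> /smooth_on_coord; apply; exact: openT.
Qed.

Lemma smooth_lsubmx m n : smooth_on setT (@lsubmx R 1 m n).
Proof.
apply/smooth_on_coord => [|i j]; first exact: openT.
by under eq_fun do rewrite mxE; exact: smooth_coord.
Qed.

Lemma smooth_rsubmx m n : smooth_on setT (@rsubmx R 1 m n).
Proof.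
apply/smooth_on_coord => [|i j]; first exact: openT.
by under eq_fun do rewrite mxE; exact: smooth_coord.
Qed.

Lemma smooth_mulmx V m n p (f : V -> 'M[R]_(m, n)) (g : V -> 'M[R]_(n, p)) :
  smooth_on setT f -> smooth_on setT g -> smooth_on setT (fun x => f x *m g x).
Proof.
move=> /smooth_on_coord fs /smooth_on_coord gs; apply/smooth_on_coord => [|i j k].
  exact: openT.
under eq_fun do rewrite mxE.
apply: Ck_on_sum => [|l]; first exact: openT.
by apply: Ck_on_mul; [exact: openT|apply: fs; exact: openT|apply: gs; exact: openT].
Qed.

End SmoothAt.

(** * Smoothness in charts *)

Section SmoothWrt.
Context {R : realType}.
Implicit Types S T : topologicalType.

(* Near [x], [h] factors smoothly through the coordinates [c]. Unlike [in_coords],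
   this fixes no domain and is stable under pullback. *)
Definition smooth_wrt {T n m} (c : T -> 'rV[R]_n) (h : T -> 'rV[R]_m) (x : T) :=
  exists2 H, smooth_at H (c x) & {near x, h =1 H \o c}.

Lemma smooth_wrt_refl T n (c : T -> 'rV[R]_n) x : smooth_wrt c c x.
Proof.
exists id; last exact: nearW.
by exists setT => [|k]; [split=> //; exact: openT|exact: Ck_on_id].
Qed.

Lemma smooth_wrt_cst T n m (c : T -> 'rV[R]_n) (a : 'rV[R]_m) x :
  smooth_wrt c (fun=> a) x.
Proof.
exists (fun=> a); last exact: nearW.
by exists setT => [|k]; [split=> //; exact: openT|exact: Ck_on_cst].
Qed.

Lemma near_eq_smooth_wrt T n m (c : T -> 'rV[R]_n) (h h' : T -> 'rV[R]_m) x :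
  {near x, h =1 h'} -> smooth_wrt c h x -> smooth_wrt c h' x.
Proof. by move=> hh' [H sH hH]; exists H => //; apply: filterS2 hh' hH => y ->. Qed.

(** If [B] reads [b \o f] in [c] and [H] reads [h] in [b], then [H \o B] reads [h \o f] in [c].
    Continuity of [f] pulls back the neighbourhood on which [H] is valid. *)
Lemma smooth_wrt_pullback S T n m p (c : S -> 'rV[R]_n) (b : T -> 'rV[R]_m)
    (f : S -> T) (h : T -> 'rV[R]_p) x : {for x, continuous f} ->
  smooth_wrt c (b \o f) x -> smooth_wrt b h (f x) -> smooth_wrt c (h \o f) x.
Proof.
move=> fx [B sB bB] [H sH hH]; exists (H \o B).
  by apply: smooth_at_comp => //; have := nbhs_singleton bB => /= <-.
by have := fx _ hH; apply: filterS2 bB => y /= by_ ->; rewrite by_.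
Qed.

Lemma smooth_wrt_trans T n m p (c : T -> 'rV[R]_n) (b : T -> 'rV[R]_m)
    (h : T -> 'rV[R]_p) x :
  smooth_wrt c b x -> smooth_wrt b h x -> smooth_wrt c h x.
Proof. by move=> cb bh; apply: (smooth_wrt_pullback (f := id) _ cb bh); exact: cvg_id. Qed.

Lemma smooth_wrt_comp T n m p (c : T -> 'rV[R]_n) (h : T -> 'rV[R]_m)
    (H : 'rV[R]_m -> 'rV[R]_p) x :
  smooth_on setT H -> smooth_wrt c h x -> smooth_wrt c (H \o h) x.
Proof.
move=> sH ch; apply: smooth_wrt_trans ch _; exists H; last exact: nearW.
by apply: smooth_at_on sH _ => //; exact: openT.
Qed.

Lemma smooth_wrt_row_mx T n m p (c : T -> 'rV[R]_n) (h : T -> 'rV[R]_m)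
    (h' : T -> 'rV[R]_p) x : smooth_wrt c h x -> smooth_wrt c h' x ->
  smooth_wrt c (fun y => row_mx (h y) (h' y)) x.
Proof.
move=> [H sH hH] [H' sH' hH']; exists (fun y => row_mx (H y) (H' y)).
  exact: smooth_at_row_mx.
by apply: filterS2 hH hH' => y /= -> ->.
Qed.

Lemma smooth_wrt_continuous T n m (c : T -> 'rV[R]_n) (h : T -> 'rV[R]_m) x :
  {for x, continuous c} -> smooth_wrt c h x -> {for x, continuous h}.
Proof.
move=> cx [H sH hH]; apply: (@near_eq_continuous _ _ (H \o c)).
  by apply: filterS hH => y.
by apply: continuous_comp => //; exact: smooth_at_continuous.
Qed.

(** Injectivity of [c] on its domain makes the value picked by [xget] independent of the chosen
    preimage. *)
Lemma in_coordsE T n m (c : chart R n T) (A : set T) (h : T -> 'rV[R]_m) x :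
  is_chart c -> A `<=` cdom c -> A x -> in_coords c A h (c x) = h x.
Proof.
move=> [_ ci _ _] Ac Ax; rewrite /in_coords; case: xgetP => [_ -> [y [Ay /= e] <-]|].
  by congr h; apply: ci e; apply/mem_set; exact: Ac.
by move=> /(_ (h x))[]; exists x.
Qed.

(** In one direction [in_coords] itself is the local factor. In the other, [c] is an open map on its
    domain, so a factor valid near [x] agrees with [in_coords] on a neighbourhood of [c x]. *)
Lemma smooth_in_coordsP T n m (c : chart R n T) (A : set T) (h : T -> 'rV[R]_m) :
  is_chart c -> open A -> A `<=` cdom c ->
  smooth_on (c @` A) (in_coords c A h) <-> forall x, A x -> smooth_wrt c h x.
Proof.
move=> cc oA Ac; have [od ci cx co] := cc; split=> [s x Ax|s].
  exists (in_coords c A h); first by apply: smooth_at_on s _; [exact: co|exists x].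
  have := open_nbhs_nbhs (conj oA Ax); apply: filterS => y Ay /=.
  by rewrite in_coordsE.
apply: smooth_on_at => _ [x Ax <-]; have [H sH] := s _ Ax; rewrite /prop_near1 {1}nbhsE.
move=> [P [oP Px] hP]; apply: near_eq_smooth_at sH.
have oAP : open (A `&` P) by exact: openI.
have : open_nbhs (c x) (c @` (A `&` P)).
  by split; [apply: co => // y []/Ac|exists x].
move=> /open_nbhs_nbhs; apply: filterS => _ [y [Ay Py] <-].
by rewrite in_coordsE// hP.
Qed.

Lemma compatibleP T n (c e : chart R n T) : is_chart c -> is_chart e ->
  compatible c e <->
  forall x, cdom c x -> cdom e x -> smooth_wrt c e x /\ smooth_wrt e c x.
Proof.
move=> cc ce; have [[oc _ _ _] [oe _ _ _]] := (cc, ce).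
have oce : open (cdom c `&` cdom e) by exact: openI.
rewrite /compatible /=; split=> [[/smooth_in_coordsP h /smooth_in_coordsP h'] x cx ex|h].
  by split; [apply: h|apply: h'].
by split; apply/smooth_in_coordsP => // x [cx ex]; have [] := h _ cx ex.
Qed.

Section SmoothMap.
Variables (n m : nat) (S T : topologicalType).
Variables (A : set (chart R n S)) (B : set (chart R m T)).
Hypothesis A_chart : forall c, A c -> is_chart c.
Hypothesis B_open : forall e, B e -> open (cdom e).
Variables (D : set S) (f : S -> T).
Hypothesis D_open : open D.

Let dom_open c e : A c -> B e -> (forall x, D x -> {for x, continuous f}) ->
  open (cdom c `&` D `&` f @^-1` cdom e).
Proof.
move=> Ac Be fD; rewrite openE => x [[cx Dx] ex]; apply: filterI.
  by apply: open_nbhs_nbhs; split=> //; apply: openI => //; have [] := A_chart Ac.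
by apply: fD => //; apply: open_nbhs_nbhs; split=> //; exact: B_open.
Qed.

(** Continuity of [f] on the open set [D] makes the domain attached to each pair of charts open, so
    that [smooth_in_coordsP] applies to it. *)
Lemma smooth_mapP : smooth_map A B D f <->
  (forall x, D x -> {for x, continuous f}) /\
  forall c e x, A c -> B e -> cdom c x -> D x -> cdom e (f x) ->
    smooth_wrt c (e \o f) x.
Proof.
split=> -[fD h]; split=> // c e.
  move=> x Ac Be cx Dx ex; have := h _ _ Ac Be.
  move=> /smooth_in_coordsP; apply=> //; first exact: A_chart.
    exact: dom_open.
  by move=> y [[]].
move=> Ac Be; apply/smooth_in_coordsP; first exact: A_chart.
  exact: dom_open.
by move=> y [[]].
by move=> x [[cx Dx] ex]; exact: h.
Qed.

End SmoothMap.

Lemma euclidean_chart n c : euclidean_atlas R n c -> is_chart c.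
Proof.
move=> ->; split=> //=; first exact: openT; first by move=> x _; exact: cvg_id.
by move=> A oA _; rewrite image_id.
Qed.

Lemma row_mx_continuous m n : continuous (fun p : 'rV[R]_m * 'rV[R]_n => row_mx p.1 p.2).
Proof.
(* Order 0 of [Ck_on] is continuity, so [Ck_on_coord] reduces the claim to single entries. *)
suff h : Ck_on 0 setT (fun p : 'rV[R]_m * 'rV[R]_n => row_mx p.1 p.2).
  by move=> p; exact: (h p I).
apply/Ck_on_coord => [|i j p _]; first exact: openT.
rewrite -(fintype.splitK j); case: (fintype.split j) => l /=.
  apply: (@near_eq_continuous _ _ ((fun M : 'rV[R]_m => M i l) \o fst)).
    by apply: (@filterE _ (nbhs p) (nbhs_filter p)) => q /=; rewrite row_mxEl.
  by apply: continuous_comp; [exact: cvg_fst|exact: coord_continuous].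
apply: (@near_eq_continuous _ _ ((fun M : 'rV[R]_n => M i l) \o snd)).
  by apply: (@filterE _ (nbhs p) (nbhs_filter p)) => q /=; rewrite row_mxEr.
by apply: continuous_comp; [exact: cvg_snd|exact: coord_continuous].
Qed.

Lemma prod_is_chart S T n m (c : chart R n S) (e : chart R m T) :
  is_chart c -> is_chart e -> is_chart (prod_chart c e).
Proof.
move=> [oc ic cc pc] [oe ie ce pe]; split=> /=.
- rewrite openE => -[x y] [/= cx ey].
  exists (cdom c, cdom e) => //=; split; exact: open_nbhs_nbhs.
- move=> [x y] [x' y'] /set_mem[/= cx ey] /set_mem[/= cx' ey'] /eq_row_mx[e1 e2].
  by congr pair; [apply: ic|apply: ie] => //; exact/mem_set.
- move=> [x y] [/= cx ey].
  apply: (@continuous_comp _ _ _ (fun p : S * T => (c p.1, e p.2))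
     (fun p => row_mx p.1 p.2)); last exact: row_mx_continuous.
  apply: (continuous_pair (f := c \o fst) (h := e \o snd)).
    by apply: continuous_comp; [exact: cvg_fst|exact: cc].
  by apply: continuous_comp; [exact: cvg_snd|exact: ce].
- move=> A oA Ace; rewrite openE => _ [[x y] Axy <-].
  have [/= cx ey] := Ace _ Axy.
  have [[P Q] /= [Px Qy] PQ] : nbhs (x, y) A by exact: open_nbhs_nbhs.
  move: Px Qy; rewrite !nbhsE => -[P' [oP' P'x] P'P] [Q' [oQ' Q'y] Q'Q].
  (* A row whose left block lies in [X] and right block in [Y] comes from a point of [A]. These two
     conditions are open because [X], [Y] are open and block extraction is continuous. *)
  pose X := c @` (cdom c `&` P'); pose Y := e @` (cdom e `&` Q').
  have oX : open X by apply: pc => [|z []//]; exact: openI.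
  have oY : open Y by apply: pe => [|z []//]; exact: openI.
  pose l := @lsubmx R 1 n m; pose r := @rsubmx R 1 n m.
  have lX : \forall z \near row_mx (c x) (e y), X (l z).
    have lc := (smooth_at_continuous (smooth_at_on openT (@smooth_lsubmx R n m) I)).
    apply: (lc (row_mx (c x) (e y))).
    by rewrite /= row_mxKl; apply: open_nbhs_nbhs; split=> //; exists x.
  have rY : \forall z \near row_mx (c x) (e y), Y (r z).
    have rc := (smooth_at_continuous (smooth_at_on openT (@smooth_rsubmx R n m) I)).
    apply: (rc (row_mx (c x) (e y))).
    by rewrite /= row_mxKr; apply: open_nbhs_nbhs; split=> //; exists y.
  apply: filterS2 lX rY => z [x' [cx' Px'] x'z] [y' [ey' Qy'] y'z].
  exists (x', y'); last by rewrite /= x'z y'z hsubmxK.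
  by apply: PQ; split=> /=; [exact: P'P|exact: Q'Q].
Qed.

Lemma smooth_wrt_prod_fst S T n m p (c : S -> 'rV[R]_n) (e : T -> 'rV[R]_m)
    (h : S -> 'rV[R]_p) x : smooth_wrt c h x.1 ->
  smooth_wrt (fun q => row_mx (c q.1) (e q.2)) (h \o fst) x.
Proof.
move=> ch; apply: smooth_wrt_pullback ch; first exact: cvg_fst.
apply: near_eq_smooth_wrt (smooth_wrt_comp (@smooth_lsubmx R n m) (smooth_wrt_refl _ _)).
by apply: (@filterE _ (nbhs x) (nbhs_filter x)) => q /=; rewrite row_mxKl.
Qed.

Lemma smooth_wrt_prod_snd S T n m p (c : S -> 'rV[R]_n) (e : T -> 'rV[R]_m)
    (h : T -> 'rV[R]_p) x : smooth_wrt e h x.2 ->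
  smooth_wrt (fun q => row_mx (c q.1) (e q.2)) (h \o snd) x.
Proof.
move=> ch; apply: smooth_wrt_pullback ch; first exact: cvg_snd.
apply: near_eq_smooth_wrt (smooth_wrt_comp (@smooth_rsubmx R n m) (smooth_wrt_refl _ _)).
by apply: (@filterE _ (nbhs x) (nbhs_filter x)) => q /=; rewrite row_mxKr.
Qed.

End SmoothWrt.
Arguments smooth_mapP {R n m S T A B} _ _ {D f} _.

(** * Final topologies *)

(* A copy of [T], for the final topology of the maps [psi i] restricted to the
   interior of [D i]; the interior is there to make [setT] open for every [D]. *)
Definition glued (X : topologicalType) (T I : Type) (D : I -> set X)
  (psi : I -> X -> T) : Type := T.

Section GluedTopology.
Variables (X : topologicalType) (T : choiceType) (I : Type).
Variables (D : I -> set X) (psi : I -> X -> T).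

Definition glued_open : set_system T :=
  [set A | forall i, open ((D i)^° `&` psi i @^-1` A)].

Lemma glued_openT : glued_open setT.
Proof. by move=> i; rewrite preimage_setT setIT; exact: open_interior. Qed.

Lemma glued_openI : setI_closed glued_open.
Proof.
by move=> A B oA oB i; rewrite preimage_setI -(setIid (D i)^°) setIACA; exact: openI.
Qed.

Lemma glued_open_bigcup (J : Type) (f : J -> set T) :
  (forall j, glued_open (f j)) -> glued_open (\bigcup_j f j).
Proof.
move=> of_ i; rewrite preimage_bigcup setI_bigcupr.
by apply: bigcup_open => j _; exact: of_.
Qed.

HB.instance Definition _ := Choice.copy (glued D psi) T.
HB.instance Definition _ := @isOpenTopological.Build (glued D psi) glued_open
  glued_openT glued_openI glued_open_bigcup.

End GluedTopology.

Section GluedTheory.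
Variables (X : topologicalType) (T : choiceType) (I : Type).
Variables (D : I -> set X) (E : I -> set T) (psi : I -> X -> T) (kappa : I -> T -> X).
Let L : topologicalType := glued D psi.

Hypothesis D_open : forall i, open (D i).
Hypothesis psiE : forall i x, D i x -> E i (psi i x).
Hypothesis kappaD : forall i t, E i t -> D i (kappa i t).
Hypothesis psiK : forall i x, D i x -> kappa i (psi i x) = x.
Hypothesis kappaK : forall i t, E i t -> psi i (kappa i t) = t.
Hypothesis trans_near : forall i j x, D j x -> E i (psi j x) ->
  \forall y \near x, E i (psi j y).
Hypothesis trans_continuous : forall i j x, D j x -> E i (psi j x) ->
  {for x, continuous (kappa i \o psi j)}.

Lemma glued_openE (A : set L) : open A <-> forall i, open (D i `&` psi i @^-1` A).
Proof.
suff -> : open A = glued_open D psi A.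
  by split=> oA i; have := oA i; rewrite (interior_id _).1.
by [].
Qed.

Lemma glued_dom_open i : open (E i : set L).
Proof.
apply/glued_openE => j; rewrite openE => x [Dx Ex]; apply: filterI.
  exact: open_nbhs_nbhs.
exact: trans_near.
Qed.

Lemma glued_map_continuous i x : D i x -> {for x, continuous (psi i : X -> L)}.
Proof.
move=> Dx A; rewrite nbhsE => -[A' [oA' A'x] A'A].
have /glued_openE/(_ i) oD := oA'.
have : nbhs x (D i `&` psi i @^-1` A') by exact: open_nbhs_nbhs.
by apply: filterS => y [_ /A'A].
Qed.

(** Seen through [psi j], the image of [A] is locally the preimage of [A] under the transition
    [kappa i \o psi j], which is continuous. *)
Lemma glued_map_open i (A : set X) :
  open A -> A `<=` D i -> open (psi i @` A : set L).
Proof.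
move=> oA AD; apply/glued_openE => j; rewrite openE => x [Dx [a Aa ax]].
have Ex : E i (psi j x) by rewrite -ax; apply: psiE; exact: AD.
apply: filterI; first exact: open_nbhs_nbhs.
have /= xa : kappa i (psi j x) = a by rewrite -ax psiK//; exact: AD.
have := trans_continuous Dx Ex; move=> /(_ A) /=; rewrite /= xa => /(_ _)/= nA.
have {}nA : nbhs x ((kappa i \o psi j) @^-1` A) by apply: nA; exact: open_nbhs_nbhs.
apply: filterS2 (trans_near Dx Ex) nA => y Ey Ay /=.
by exists (kappa i (psi j y)); last exact: kappaK.
Qed.

Lemma glued_inv_continuous i t : E i t -> {for t, continuous (kappa i : L -> X)}.
Proof.
move=> Et A; rewrite nbhsE => -[A' [oA' A't] A'A].
have : nbhs (t : L) (psi i @` (D i `&` A')).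
  apply: open_nbhs_nbhs; split; first by apply: glued_map_open => [|x []//]; exact: openI.
  by exists (kappa i t); [split=> //; exact: kappaD|exact: kappaK].
by apply: filterS => _ [x [Dx A'x] <-]; rewrite /= psiK//; exact: A'A.
Qed.

(** A base is given by the images under the open maps [psi i] of [D i] met with members of a
    countable base of [X]; there are countably many since [I] is countable. *)
Lemma glued_second_countable : countable [set: I] -> @second_countable X ->
  (forall t, exists i, E i t) -> @second_countable L.
Proof.
move=> cI [BX cBX [oB bB]] Ecover.
exists [set psi p.1 @` (D p.1 `&` p.2) | p in [set: I] `*` BX].
  by apply: card_le_trans (card_image_le _ _) _; exact: countableX.
split=> [_ [[i b] [_ /= /oB ob] <-]|t A].
  by apply: glued_map_open => [|x []//]; exact: openI.
move=> ntA; have [i Et] := Ecover t.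
have Dt := kappaD Et.
have nA : nbhs (kappa i t) (psi i @^-1` A).
  by apply: (glued_map_continuous Dt); rewrite kappaK.
have [b [Bb bt] bA] := bB _ _ nA.
exists (psi i @` (D i `&` b)).
  split; first by exists (i, b).
  by exists (kappa i t); [split|exact: kappaK].
by move=> _ [x [_ /bA]] Ax <-.
Qed.

End GluedTheory.

(** * Countability and separation for products and row spaces *)

Lemma prod_second_countable (X Y : topologicalType) :
  @second_countable X -> @second_countable Y -> @second_countable (X * Y)%type.
Proof.
move=> [BX cBX [oX bX]] [BY cBY [oY bY]].
exists [set p.1 `*` p.2 | p in BX `*` BY].
  by apply: card_le_trans (card_image_le _ _) _; exact: countableX.
split=> [_ [[b b'] [/= /oX ob /oY ob'] <-]|[x y] A [[P Q] /= [Px Qy] PQA]].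
  rewrite openE => -[x y] [/= bx b'y].
  by exists (b, b') => //=; split; exact: open_nbhs_nbhs.
have [b [Bb bx] bP] := bX _ _ Px; have [b' [Bb' b'y] b'Q] := bY _ _ Qy.
exists (b `*` b'); first by split=> //; exists (b, b').
by move=> [u v] [/= /bP Pu /b'Q Qv]; exact: PQA.
Qed.

Lemma row_second_countable (R : realType) n : @second_countable 'rV[R]_n.
Proof.
pose b (p : 'rV[rat]_n * nat) : set 'rV[R]_n :=
  (ball (map_mx ratr p.1 : 'rV[R]_n) p.2.+1%:R^-1)^°.
exists (range b).
  exact: card_le_trans (card_image_le _ _) (countableP _).
split=> [_ [p _ <-]|x A]; first exact: open_interior.
rewrite -nbhs_ballE => -[e /= e0 eA].
(* Two points of a ball of radius below [e / 2] are less than [e] apart, so such a ball with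
   rational centre lies in the [e]-ball around [x] as soon as it contains [x]. *)
have [k] : exists k, 0 + k.+1%:R^-1 < e / 2 by apply: ltr_add_invr; rewrite divr_gt0.
rewrite add0r => ke.
have qP j : exists q : rat, `|x ord0 j - ratr q| < k.+1%:R^-1.
  have : x ord0 j < x ord0 j + k.+1%:R^-1 by rewrite ltrDl invr_gt0.
  move=> /rat_in_itvoo[q]; rewrite in_itv/= => /andP[xq qx]; exists q.
  by rewrite distrC gtr0_norm ?subr_gt0// ltrBlDl.
have [q qE] := choice qP.
have xb : ball (map_mx ratr (\row_j q j) : 'rV[R]_n) k.+1%:R^-1 x.
  split; first by rewrite invr_gt0.
  by move=> i j; rewrite !mxE (ord1 i) -ball_normE /= distrC.
exists (b (\row_j q j, k)).
  split; first by exists (\row_j q j, k).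
  rewrite /b /=; apply: open_nbhs_nbhs; split=> //.
  exact: ball_open.
move=> y /interior_subset /= qy; apply: eA.
rewrite (splitr e); apply: (@ball_triangle _ _ (map_mx ratr (\row_j q j) : 'rV[R]_n)).
  by apply: ball_sym; apply: le_ball xb; exact: ltW.
by apply: le_ball qy; exact: ltW.
Qed.

(** This transfers separation from [Z] to [Y]. Continuity at the two points is enough, so it also
    applies to maps such as [kappa i] that are only meaningful on part of the space. *)
Lemma cluster_continuous (Y Z : topologicalType) (f : Y -> Z) (p q : Y) :
  hausdorff_space Z -> {for p, continuous f} -> {for q, continuous f} ->
  cluster (nbhs p) q -> f p = f q.
Proof.
move=> hZ fp fq pq; apply: hZ => A A' nA nA'.
by have [x [Ax A'x]] := pq _ _ (fp _ nA) (fq _ nA'); exists (f x).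
Qed.

Lemma prod_hausdorff (Y Z : topologicalType) :
  hausdorff_space Y -> hausdorff_space Z -> hausdorff_space (Y * Z)%type.
Proof.
move=> hY hZ [y z] [y' z'] pq; congr pair.
  by apply: (cluster_continuous (f := @fst Y Z) hY) pq; exact: cvg_fst.
by apply: (cluster_continuous (f := @snd Y Z) hZ) pq; exact: cvg_snd.
Qed.

(** * The associated bundle *)

Section Multilinear.
Context {R : realType}.

Lemma mul_lin1_mx m n (f : 'rV[R]_m -> 'rV[R]_n) u :
  linear f -> u *m lin1_mx f = f u.
Proof.
move=> lf; pose fM := GRing.isLinear.Build _ _ _ _ _ lf.
exact: (mul_rV_lin1 (HB.pack f fM : {linear 'rV[R]_m -> 'rV[R]_n})).
Qed.

Lemma linear_comp_op (U V W : lmodType R) (f : V -> W) (g : U -> V) :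
  linear f -> linear g -> linear (f \o g).
Proof. by move=> lf lg a u v /=; rewrite lg lf. Qed.

(** The value is the product of the row [f x] with the matrix of [l x], whose rows are smooth by
    hypothesis. Used once per argument, this gives the smoothness of multilinear maps. *)
Lemma smooth_linear_app (V : normedModType R) m n (l : V -> 'rV[R]_m -> 'rV[R]_n)
    (f : V -> 'rV[R]_m) : (forall x, linear (l x)) ->
  (forall i, smooth_on setT (fun x => l x (delta_mx 0 i))) ->
  smooth_on setT f -> smooth_on setT (fun x => l x (f x)).
Proof.
move=> ll sl sf; under eq_fun do rewrite -mul_lin1_mx//.
apply: smooth_mulmx => //; apply/smooth_on_coord => [|i j]; first exact: openT.
under eq_fun do rewrite mxE.
by have /smooth_on_coord := sl i; apply; exact: openT.
Qed.

Context {F : vectType R}.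
Let r := \dim {:F}.

Lemma vcoordsK : cancel (@vcoords R F) vfrom.
Proof. exact/passmx.rVofK/vbasisP. Qed.

Lemma vfromK : cancel (@vfrom R F) vcoords.
Proof. exact/passmx.vecofK/vbasisP. Qed.

Lemma vcoords_linear : linear (@vcoords R F).
Proof. exact: passmx.rVof_linear. Qed.

Lemma vfrom_linear : linear (@vfrom R F).
Proof. exact: passmx.vecof_linear. Qed.

Lemma end_matrixE (f : F -> F) (v : 'rV[R]_r) :
  linear f -> v *m end_matrix f = vcoords (f (vfrom v)).
Proof.
move=> lf; rewrite /end_matrix mul_lin1_mx//.
by apply: linear_comp_op vfrom_linear; apply: linear_comp_op vcoords_linear lf.
Qed.

Lemma smooth_bilinear (V : normedModType R) (b : F -> F -> F) (f g : V -> 'rV[R]_r) :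
  bilinear_op b -> smooth_on setT f -> smooth_on setT g ->
  smooth_on setT (fun x => vcoords (b (vfrom (f x)) (vfrom (g x)))).
Proof.
move=> [b1 b2] sf sg.
apply: (smooth_linear_app (l := fun x u => vcoords (b (vfrom u) (vfrom (g x))))) sf.
  by move=> x a u v; rewrite vfrom_linear b1 vcoords_linear.
move=> i.
apply: (smooth_linear_app (l := fun x u => vcoords (b (vfrom (delta_mx 0 i)) (vfrom u)))) sg.
  by move=> x a u v; rewrite vfrom_linear b2 vcoords_linear.
by move=> j k; exact: Ck_on_cst.
Qed.

Lemma smooth_trilinear (V : normedModType R) (t : F -> F -> F -> F)
    (f g h : V -> 'rV[R]_r) : trilinear_op t ->
  smooth_on setT f -> smooth_on setT g -> smooth_on setT h ->
  smooth_on setT (fun x => vcoords (t (vfrom (f x)) (vfrom (g x)) (vfrom (h x)))).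
Proof.
move=> [t1 t2 t3] sf sg sh.
apply: (smooth_linear_app
  (l := fun x u => vcoords (t (vfrom u) (vfrom (g x)) (vfrom (h x))))) sf.
  by move=> x a u v; rewrite vfrom_linear t1 vcoords_linear.
move=> i; apply: smooth_bilinear sg sh; split=> [y|x].
  exact: t2.
exact: t3.
Qed.

Lemma smooth_wrt_bilinear (T : topologicalType) n (c : T -> 'rV[R]_n)
    (b : F -> F -> F) (f g : T -> 'rV[R]_r) x : bilinear_op b ->
  smooth_wrt c f x -> smooth_wrt c g x ->
  smooth_wrt c (fun y => vcoords (b (vfrom (f y)) (vfrom (g y)))) x.
Proof.
move=> bb cf cg; have := smooth_wrt_row_mx cf cg.
move=> /(smooth_wrt_comp (smooth_bilinear bb (@smooth_lsubmx R r r) (@smooth_rsubmx R r r))).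
by congr (smooth_wrt _ _ _); apply/funext => y /=; rewrite row_mxKl row_mxKr.
Qed.

Lemma smooth_wrt_trilinear (T : topologicalType) n (c : T -> 'rV[R]_n)
    (t : F -> F -> F -> F) (f g h : T -> 'rV[R]_r) x : trilinear_op t ->
  smooth_wrt c f x -> smooth_wrt c g x -> smooth_wrt c h x ->
  smooth_wrt c (fun y => vcoords (t (vfrom (f y)) (vfrom (g y)) (vfrom (h y)))) x.
Proof.
move=> tt cf cg ch; have := smooth_wrt_row_mx cf (smooth_wrt_row_mx cg ch).
pose p2 (z : 'rV[R]_(r + (r + r))) := lsubmx (rsubmx z).
pose p3 (z : 'rV[R]_(r + (r + r))) := rsubmx (rsubmx z).
have s2 : smooth_on setT p2.
  apply/smooth_on_coord => [|i j]; first exact: openT.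
  by rewrite /p2; under eq_fun do rewrite !mxE; exact: smooth_coord.
have s3 : smooth_on setT p3.
  apply/smooth_on_coord => [|i j]; first exact: openT.
  by rewrite /p3; under eq_fun do rewrite !mxE; exact: smooth_coord.
move=> /(smooth_wrt_comp (smooth_trilinear tt (@smooth_lsubmx R r (r + r)) s2 s3)).
by congr (smooth_wrt _ _ _); apply/funext => y /=; rewrite /p2 /p3 !(row_mxKl, row_mxKr).
Qed.

End Multilinear.

(** * The total space and its transitions *)

Section AssociatedBundle.
Variables (R : realType) (F : vectType R) (B : ly_brackets F).
Variables (k : nat) (G : lie_group R k) (phi : G -> F -> F).
Variables (n : nat) (M : manifold R n) (I : Type).
Variables (U : I -> chart R n M) (g : I -> I -> M -> G).
Hypothesis B_bilinear : bilinear_op (lbr B).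
Hypothesis B_trilinear : trilinear_op (tbr B).
Hypothesis phi_smooth : smooth_action B phi.
Hypothesis U_atlas : countable_atlas U.
Hypothesis g_trans : transition_maps U g.
Variable s : M -> I.
Hypothesis U_s : forall m, cdom (U (s m)) m.

Let r := \dim {:F}.

Let U_open i : open (cdom (U i)).
Proof. by have [_ /(_ i)[[]]] := U_atlas. Qed.

Let phi_linear h : linear (phi h).
Proof. by have [/(_ h)[[]]] := phi_smooth. Qed.

Let phi_trans i j l m a : cdom (U i) m -> cdom (U j) m -> cdom (U l) m ->
  phi (g i j m) (phi (g j l m) a) = phi (g i l m) a.
Proof.
have [_ phiM _] := phi_smooth; have [_ gM] := g_trans.
by move=> im jm lm; rewrite -phiM gM.
Qed.

(** The cocycle identity with equal indices makes [phi (g i i m)] idempotent; being injective, it is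
    the identity. *)
Let phi_diag i m a : cdom (U i) m -> phi (g i i m) a = a.
Proof.
move=> im; have [/(_ (g i i m))[_ [f [_ fK _]]] _ _] := phi_smooth.
by apply: (can_inj fK); exact: phi_trans.
Qed.

Let X : topologicalType := (M * 'rV[R]_r)%type.
Let T : choiceType := (M * F)%type.
Let D (i : I) : set X := cdom (U i) `*` setT.
Let E (i : I) : set T := [set t | cdom (U i) t.1].
Let psi (i : I) (x : X) : T := (x.1, phi (g (s x.1) i x.1) (vfrom x.2)).
Let kappa (i : I) (t : T) : X := (t.1, vcoords (phi (g i (s t.1) t.1) t.2)).
Let L : topologicalType := glued D psi.

Let D_open i : open (D i).
Proof.
rewrite openE => -[m v] [/= im _]; exists (cdom (U i), setT) => //=.
by split; [apply: open_nbhs_nbhs; split=> //; exact: U_open|exact: filterT].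
Qed.

Let psiE i x : D i x -> E i (psi i x).
Proof. by move=> [im _]. Qed.

Let kappaD i t : E i t -> D i (kappa i t).
Proof. by []. Qed.

Let psiK i x : D i x -> kappa i (psi i x) = x.
Proof.
case: x => m v [/= im _]; by rewrite /kappa/= phi_trans// phi_diag// vfromK.
Qed.

Let kappaK i t : E i t -> psi i (kappa i t) = t.
Proof.
case: t => m a im; by rewrite /psi/= vcoordsK phi_trans// phi_diag.
Qed.

(** The index [s x.1] cancels by the cocycle identity, which is why a discontinuous [s] does no
    harm. *)
Let trans_snd i j (x : X) : cdom (U i) x.1 -> cdom (U j) x.1 ->
  (kappa i (psi j x)).2 = vcoords (phi (g i j x.1) (vfrom x.2)).
Proof. by move=> ix jx; rewrite /= phi_trans. Qed.

Let near_fst (A : set M) (x : X) : open A -> A x.1 -> \forall y \near x, A y.1.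
Proof.
move=> oA Ax; have : {for x, continuous (@fst M 'rV[R]_r)} by exact: cvg_fst.
by apply; exact: open_nbhs_nbhs.
Qed.

Let trans_near i j (x : X) : D j x -> E i (psi j x) -> \forall y \near x, E i (psi j y).
Proof. by move=> _ ix; apply: (near_fst (A := cdom (U i))). Qed.

Let xchart (c : chart R n M) : chart R (n + r) X := prod_chart c (Chart setT id).

Let atlas_chart c : charts (atlas M) c -> is_chart c.
Proof. exact: charts_chart. Qed.

Let xchart_chart c : charts (atlas M) c -> is_chart (xchart c).
Proof. by move=> /atlas_chart cc; apply: prod_is_chart => //; exact: euclidean_chart. Qed.

Let smooth_transition c i j m : charts (atlas M) c ->
  cdom c m -> cdom (U i) m -> cdom (U j) m ->
  smooth_wrt c (fun m => mxvec (end_matrix (phi (g i j m)))) m.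
Proof.
move=> Ac cm im jm; have [/(_ i j) gs _] := g_trans; have [_ _ phis] := phi_smooth.
have [b Ab bm] := charts_cover (lie_atlas G) (g i j m).
have ob (b' : chart R k G) : charts (lie_atlas G) b' -> open (cdom b').
  by move=> /charts_chart[].
have oij : open (cdom (U i) `&` cdom (U j)) by exact: openI.
have /(smooth_mapP atlas_chart ob oij)[gc gsm] := gs.
have eo p (b' : chart R p 'rV[R]_p) : euclidean_atlas R p b' -> open (cdom b').
  by move=> /euclidean_chart[].
have /(smooth_mapP (@charts_chart _ _ _ (lie_atlas G)) (@eo _) openT)[_ phism] := phis.
apply: (smooth_wrt_pullback (f := g i j) (h := fun h => mxvec (end_matrix (phi h)))
  (b := b) (c := c)) => //; first exact: gc.
  exact: gsm.
exact: (phism b (Chart setT id)).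
Qed.

Let smooth_trans_snd c i j (x : X) : charts (atlas M) c ->
  cdom c x.1 -> cdom (U i) x.1 -> cdom (U j) x.1 ->
  smooth_wrt (xchart c) (fun y => (kappa i (psi j y)).2) x.
Proof.
move=> Ac cx ix jx.
(* The action in coordinates is polynomial: the first [r * r] entries hold the matrix of the group
   element, the last [r] the vector. *)
pose act (z : 'rV[R]_(r * r + r)) : 'rV[R]_r := rsubmx z *m vec_mx (lsubmx z).
have sact : smooth_on setT act.
  apply: smooth_mulmx; first exact: smooth_rsubmx.
  apply/smooth_on_coord => [|a b]; first exact: openT.
  by under eq_fun do rewrite !mxE; exact: smooth_coord.
pose e (m : M) := mxvec (end_matrix (phi (g i j m))).
have := smooth_wrt_row_mx
  (smooth_wrt_prod_fst (id : 'rV[R]_r -> _) (x := x) (smooth_transition Ac cx ix jx))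
  (smooth_wrt_prod_snd c (x := x) (smooth_wrt_refl (id : 'rV[R]_r -> _) x.2)).
move=> /(smooth_wrt_comp sact); apply: near_eq_smooth_wrt.
(* The formula of [trans_snd] holds only over both chart domains; these are open, so it holds near
   [x]. *)
apply: filterS2 (near_fst (U_open i) ix) (near_fst (U_open j) jx) => y iy jy.
by rewrite trans_snd// /act /= row_mxKl row_mxKr mxvecK end_matrixE.
Qed.

Let smooth_xchart_trans c e i j (x : X) :
  charts (atlas M) c -> charts (atlas M) e ->
  cdom c x.1 -> cdom e x.1 -> cdom (U i) x.1 -> cdom (U j) x.1 ->
  smooth_wrt (xchart c) (xchart e \o kappa i \o psi j) x.
Proof.
move=> Ac Ae cx ex ix jx.
apply: (smooth_wrt_row_mx (h := e \o fst)); last exact: smooth_trans_snd.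
apply: smooth_wrt_prod_fst.
have := charts_compatible Ac Ae.
by move=> /(compatibleP (atlas_chart Ac) (atlas_chart Ae))/(_ _ cx ex)[].
Qed.

Let trans_continuous i j (x : X) : D j x -> E i (psi j x) ->
  {for x, continuous (kappa i \o psi j)}.
Proof.
move=> [jx _] ix; have [c Ac cx] := charts_cover (atlas M) x.1.
apply: (continuous_pair (f := fst)); first exact: cvg_fst.
apply: (smooth_wrt_continuous (c := xchart c)); last exact: smooth_trans_snd.
by have [_ _ + _] := xchart_chart Ac; apply.
Qed.

Let kappa_continuous i (t : L) : E i t -> {for t, continuous (kappa i : L -> X)}.
Proof. exact: glued_inv_continuous. Qed.

Let psi_continuous i (x : X) : D i x -> {for x, continuous (psi i : X -> L)}.
Proof. exact: glued_map_continuous. Qed.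

Let E_open i : open (E i : set L).
Proof. exact: (glued_dom_open (E := E)). Qed.

Let L_second_countable : @second_countable L.
Proof.
apply: (glued_second_countable (E := E) (kappa := kappa)) => //.
- by have [] := U_atlas.
- apply: prod_second_countable; first exact: charts_second_countable (atlas M).
  exact: row_second_countable.
- by move=> t; exists (s t.1); exact: U_s.
Qed.

Let proj_continuous : continuous (fst : L -> M).
Proof.
move=> t; have Et : E (s t.1) t by exact: U_s.
have h : {for t, continuous ((@fst M 'rV[R]_r) \o (kappa (s t.1) : L -> X))}.
  by apply: continuous_comp; [exact: kappa_continuous|exact: cvg_fst].
exact: h.
Qed.

(** Points over different base points are separated by the projection. Points over the same one lie
    in a common [E i], where [kappa i] separates them in a Hausdorff product. *)
Let L_hausdorff : hausdorff_space L.
Proof.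
move=> p q pq; have hM := charts_hausdorff (atlas M).
have e1 : p.1 = q.1.
  by apply: (cluster_continuous (f := fst : L -> M) hM) pq; exact: proj_continuous.
have Ep : E (s p.1) p by exact: U_s.
have Eq : E (s p.1) q by rewrite e1; exact: U_s.
rewrite -(kappaK Ep) -(kappaK Eq); congr psi.
apply: (cluster_continuous _ (kappa_continuous Ep) (kappa_continuous Eq) pq).
by apply: prod_hausdorff => //; exact: norm_hausdorff.
Qed.

(** * The smooth structure of the total space *)

Let lchart (i : I) (c : chart R n M) : chart R (n + r) L :=
  Chart ((E i : set L) `&` (fst : L -> M) @^-1` cdom c) (xchart c \o kappa i).

Let lchart_chart i c : charts (atlas M) c -> is_chart (lchart i c).
Proof.
move=> Ac; have [oc xi cx po] := xchart_chart Ac; split=> /=.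
- suff op : open ((fst : L -> M) @^-1` cdom c) by exact: (openI (@E_open i) op).
  apply: open_comp => [t _|]; first exact: proj_continuous.
  by have [] := atlas_chart Ac.
- move=> t u /set_mem[it ct] /set_mem[iu cu] e.
  rewrite -(kappaK it) -(kappaK iu); congr psi.
  by apply: xi => //; apply/mem_set.
- move=> t [it ct]; apply: continuous_comp; first exact: kappa_continuous.
  exact: cx.
- move=> A oA Asub.
  suff -> : (xchart c \o kappa i) @` A = xchart c @` (D i `&` psi i @^-1` A `&` cdom (xchart c)).
    apply: po; last by move=> x [].
    by apply: openI => //; exact: ((glued_openE D_open A).1 oA i).
  apply/seteqP; split=> [_ [t At <-]|_ [x [[ix Ax] cx'] <-]].
    have [it ct] := Asub _ At; exists (kappa i t) => //; split=> //; split=> //=.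
    by rewrite kappaK.
  by exists (psi i x); [exact: Ax|exact: (congr1 (xchart c) (psiK ix))].
Qed.

(** Inserting [psi j \o kappa j], the identity near [t], turns the map into a transition pulled back
    along [kappa j]. Chart compatibility, smoothness of the projection and smoothness of [kappa i]
    all come from here. *)
Let smooth_lchart i j c e (t : L) : charts (atlas M) c -> charts (atlas M) e ->
  cdom (lchart j c) t -> cdom e t.1 -> cdom (U i) t.1 ->
  smooth_wrt (lchart j c) (xchart e \o kappa i) t.
Proof.
move=> Ac Ae [jt ct] et it.
apply: (@near_eq_smooth_wrt R L _ _ _ (xchart e \o kappa i \o psi j \o kappa j)).
  have := open_nbhs_nbhs (conj (@E_open j) jt).
  by apply: filterS => u ju; exact: (congr1 (xchart e \o kappa i) (kappaK ju)).
apply: (@smooth_wrt_pullback R L X _ _ _ _ (xchart c)); first exact: kappa_continuous.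
  exact: smooth_wrt_refl.
exact: smooth_xchart_trans.
Qed.

Let lcharts : set (chart R (n + r) L) :=
  [set lchart p.1 p.2 | p in [set: I] `*` charts (atlas M)].

Let lchartsP i c : charts (atlas M) c -> lcharts (lchart i c).
Proof. by move=> Ac; exists (i, c). Qed.

Let L_cover (t : L) : exists2 c, lcharts c & cdom c t.
Proof.
have [c Ac ct] := charts_cover (atlas M) t.1.
by exists (lchart (s t.1) c); [exact: lchartsP|split=> //; exact: U_s].
Qed.

Let L_chart c : lcharts c -> is_chart c.
Proof. by move=> [[i c'] [_ /= Ac] <-]; exact: lchart_chart. Qed.

Let L_compatible c e : lcharts c -> lcharts e -> compatible c e.
Proof.
move=> [[i c'] [_ /= Ac] <-] [[j e'] [_ /= Ae] <-].
apply/compatibleP; [exact: lchart_chart|exact: lchart_chart|].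
by move=> t [/= it ct] [/= jt et]; split; apply: smooth_lchart.
Qed.

Let L_structure : smooth_structure R (n + r) L :=
  SmoothStructure L_hausdorff L_second_countable L_cover L_chart L_compatible.

Let total_space : manifold R (n + r) := Manifold L_structure.

Let L_open_dom c : lcharts c -> open (cdom c).
Proof. by move=> /L_chart[]. Qed.

Let M_open_dom c : charts (atlas M) c -> open (cdom c).
Proof. by move=> /atlas_chart[]. Qed.

Let X_atlas := prod_atlas (atlas M) (euclidean_atlas R r).

Let X_chart c : X_atlas c -> is_chart c.
Proof.
move=> [c' Ac [e Ae] <-]; apply: prod_is_chart; first exact: atlas_chart.
exact: euclidean_chart.
Qed.

Let X_atlasE c : X_atlas c -> exists2 c', charts (atlas M) c' & c = xchart c'.
Proof. by move=> [c' Ac [e ->] <-]; exists c'. Qed.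

Let X_open_dom c : X_atlas c -> open (cdom c).
Proof. by move=> /X_chart[]. Qed.

Let proj_smooth : smooth_map lcharts (atlas M) setT (fst : L -> M).
Proof.
apply/(smooth_mapP L_chart M_open_dom openT); split; first by move=> t _; exact: proj_continuous.
move=> _ e t [[i c] [_ /= Ac] <-] Ae [it ct] _ et.
have := smooth_wrt_comp (@smooth_lsubmx R n r) (smooth_lchart Ac Ae (conj it ct) et it).
by congr smooth_wrt; apply/funext => u /=; rewrite row_mxKl.
Qed.

Let incl (m : M) (a : F) : total_space := (m, a).

Let incl_inj m : injective (@incl m).
Proof. by move=> a b []. Qed.

Let incl_range m : range (@incl m) = (fst : L -> M) @^-1` [set m].
Proof.
by apply/seteqP; split=> [_ [a _ <-]//|[m' a] /= ->]; exists a.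
Qed.

(** Every fibre is [F] with its own linear structure, which is also the one carried over by any
    [psi i], because [G] acts linearly. *)
Definition assoc_data : bundle_data r M :=
  @BundleData R n r M total_space fst (fun=> F) incl incl_inj incl_range.

Let triv_diffeo i : diffeomorphism X_atlas lcharts
  (cdom (U i) `*` setT) ((fst : L -> M) @^-1` cdom (U i))
  (psi i : X -> L).
Proof.
split.
  apply/(smooth_mapP X_chart L_open_dom (@D_open i)); split.
    by move=> x Dx; exact: psi_continuous.
  move=> c e x /X_atlasE[c' Ac ->] [[j e'] [_ /= Ae] <-] [/= cx _] [ix _] [jx ex].
  exact: smooth_xchart_trans.
exists (kappa i : L -> X); split=> //.
- apply/(smooth_mapP L_chart X_open_dom (@E_open i)); split.
    by move=> t Et; exact: kappa_continuous.
  move=> _ e t [[j c] [_ /= Ac] <-] /X_atlasE[e' Ae ->] jt it [/= et _].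
  exact: smooth_lchart.
- by move=> x [].
- by move=> x /set_mem Dx; exact: psiK.
- by move=> t /set_mem Et; exact: kappaK.
Qed.

Definition assoc_triv (i : I) : local_triv assoc_data F.
Proof.
refine (@LocalTriv R n r M assoc_data F (cdom (U i))
  (fun m => phi (g (s m) i m)) (fun m => phi (g i (s m) m)) (U_open i) _ _ _ (triv_diffeo i)).
- by move=> m _; exact: phi_linear.
- by move=> m im a; rewrite phi_trans// phi_diag.
- by move=> m im a; rewrite phi_trans// phi_diag.
Defined.

Lemma assoc_locally_trivial m : exists t : local_triv assoc_data F, lt_dom t m.
Proof. by exists (assoc_triv (s m)); exact: U_s. Qed.

Definition assoc_bundle : vector_bundle M F :=
  @VectorBundle R n M F assoc_data proj_smooth assoc_locally_trivial.

(** * Smoothness of the brackets in an arbitrary trivialization *)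

Section Sections.
Variable t : local_triv assoc_data F.

Let t_open : open (lt_dom t `*` setT : set X).
Proof.
rewrite openE => -[m v] [/= im _]; exists (lt_dom t, setT) => //=.
by split; [apply: open_nbhs_nbhs; split=> //; exact: lt_open|exact: filterT].
Qed.

(* The section [m |-> t_m x] read in the [i]-th trivialization. *)
Let smooth_triv c i m (x : F) : charts (atlas M) c ->
  cdom c m -> cdom (U i) m -> lt_dom t m ->
  smooth_wrt c (fun m => vcoords (phi (g i (s m) m) (lt_fun t m x))) m.
Proof.
move=> Ac cm im tm.
have [/(smooth_mapP X_chart L_open_dom t_open)[_ ts] _] := lt_diffeo t.
have Xc : X_atlas (xchart c) by exists c => //; exists (Chart setT id).
have := ts _ _ (m, vcoords x) Xc (lchartsP i Ac) (conj cm Logic.I) (conj tm Logic.I) (conj im cm).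
move=> /(smooth_wrt_pullback (f := fun m => (m, vcoords x)) (c := c) (x := m)).
have h1 : {for m, continuous (fun m => (m, vcoords x) : X)}.
  by apply: (continuous_pair (f := id)); [exact: cvg_id|exact: cvg_cst].
move=> /(_ h1 (smooth_wrt_row_mx (smooth_wrt_refl _ _) (smooth_wrt_cst _ _ _))).
move=> /(smooth_wrt_comp (@smooth_rsubmx R n r)).
by congr smooth_wrt; apply/funext => m' /=; rewrite row_mxKr vcoordsK.
Qed.

(** A section that is smooth in the constructed trivializations is a smooth map into the total
    space; composing it with the smooth inverse of the trivialization [t] gives its coordinates in
    [t]. *)
Let smooth_section (b : M -> F) : (forall c i m, charts (atlas M) c ->
    cdom c m -> cdom (U i) m -> lt_dom t m ->
    smooth_wrt c (fun m => vcoords (phi (g i (s m) m) (b m))) m) ->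
  smooth_map (atlas M) (euclidean_atlas R r) (lt_dom t)
    (fun m => vcoords (@lt_inv _ _ _ _ _ _ t m (b m))).
Proof.
move=> sb; have [_ [f' [sf' _ _ ff' _]]] := lt_diffeo t.
(* The inverse [f'] provided by [lt_diffeo] is an unspecified map; as an inverse of the
   trivialization, it must be given by [lt_inv]. *)
have f'E m w : lt_dom t m -> f' (incl m w) = (m, vcoords (@lt_inv _ _ _ _ _ _ t m w)).
  move=> tm; have := ff' (m, vcoords (@lt_inv _ _ _ _ _ _ t m w)).
  by rewrite /= vcoordsK lt_invK// => <-//; apply/mem_set.
have proj_open : open ((fst : L -> M) @^-1` lt_dom t).
  apply: open_comp => [u _|]; first exact: proj_continuous.
  exact: lt_open.
have [_ f's] := (smooth_mapP L_chart X_open_dom proj_open).1 sf'.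
have sm c m : charts (atlas M) c -> cdom c m -> lt_dom t m ->
    smooth_wrt c (fun m => vcoords (@lt_inv _ _ _ _ _ _ t m (b m))) m.
  move=> Ac cm tm; pose i := s m.
  have im : cdom (U i) m by exact: U_s.
  have sZ := sb c i m Ac cm im tm.
  pose s2 (m : M) : L := (m, b m).
  (* Near [m] the section is [psi i] applied to its continuous reading in the i-th
     trivialization. *)
  have s2c : {for m, continuous s2}.
    apply: (@near_eq_continuous _ _
      ((psi i : X -> L) \o (fun m => (m, vcoords (phi (g i (s m) m) (b m)))))).
      have := open_nbhs_nbhs (conj (U_open i) im).
      by apply: filterS => m' im'; exact: (@kappaK i (m', b m')).
    apply: continuous_comp; last exact: psi_continuous.
    apply: (continuous_pair (f := id)); first exact: cvg_id.
    apply: (smooth_wrt_continuous _ sZ).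
    by have [_ _ + _] := atlas_chart Ac; apply.
  have Xc : X_atlas (xchart c) by exists c => //; exists (Chart setT id).
  have cf' : cdom (xchart c) (f' (s2 m)) by rewrite [f' _]f'E.
  have := f's _ _ (s2 m) (lchartsP i Ac) Xc (conj im cm) tm cf'.
  have h1 : smooth_wrt c (lchart i c \o s2) m.
    exact: smooth_wrt_row_mx (smooth_wrt_refl _ _) sZ.
  move=> /(smooth_wrt_pullback s2c h1)/(smooth_wrt_comp (@smooth_rsubmx R n r)).
  apply: near_eq_smooth_wrt.
  have := open_nbhs_nbhs (conj (lt_open t) tm).
  by apply: filterS => m' tm'; rewrite /= [f' _]f'E//= row_mxKr.
apply/(smooth_mapP atlas_chart _ (lt_open t)) => [e /euclidean_chart[]//|].
split=> [m tm|c e m Ac -> cm tm _]; last exact: sm.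
have [c Ac cm] := charts_cover (atlas M) m.
apply: (smooth_wrt_continuous _ (sm c m Ac cm tm)).
by have [_ _ + _] := atlas_chart Ac; apply.
Qed.

Let phi_lbr h x y : phi h (lbr B x y) = lbr B (phi h x) (phi h y).
Proof. by have [/(_ h)[[]]] := phi_smooth. Qed.

Let phi_tbr h x y z : phi h (tbr B x y z) = tbr B (phi h x) (phi h y) (phi h z).
Proof. by have [/(_ h)[[]]] := phi_smooth. Qed.

(** Since [phi h] preserves the bracket, the bracket of two sections reads in the i-th
    trivialization as the fixed bilinear map [lbr B] of their readings, which [smooth_triv] shows to
    be smooth. *)
Lemma assoc_lbr_smooth (x y : F) :
  smooth_map (atlas M) (euclidean_atlas R r) (lt_dom t)
    (fun m => vcoords (lt_inv t (lbr B (lt_fun t m x) (lt_fun t m y) : fibre assoc_data m))).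
Proof.
apply: (@smooth_section (fun m => lbr B (lt_fun t m x) (lt_fun t m y))).
move=> c i m Ac cm im tm.
have := smooth_wrt_bilinear B_bilinear (smooth_triv x Ac cm im tm) (smooth_triv y Ac cm im tm).
by congr smooth_wrt; apply/funext => m'; rewrite !vcoordsK phi_lbr.
Qed.

Lemma assoc_tbr_smooth (x y z : F) :
  smooth_map (atlas M) (euclidean_atlas R r) (lt_dom t)
    (fun m => vcoords (lt_inv t
      (tbr B (lt_fun t m x) (lt_fun t m y) (lt_fun t m z) : fibre assoc_data m))).
Proof.
apply: (@smooth_section (fun m => tbr B (lt_fun t m x) (lt_fun t m y) (lt_fun t m z))).
move=> c i m Ac cm im tm.
have := smooth_wrt_trilinear B_trilinear (smooth_triv x Ac cm im tm)
  (smooth_triv y Ac cm im tm) (smooth_triv z Ac cm im tm).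
by congr smooth_wrt; apply/funext => m'; rewrite !vcoordsK phi_tbr.
Qed.

End Sections.

Let brackets (m : M) : ly_brackets (fibre assoc_bundle m) := B.

Lemma assoc_field2 : field2 (fun m => lbr (brackets m)).
Proof. by split=> [m|t x y]; [exact: B_bilinear|exact: assoc_lbr_smooth]. Qed.

Lemma assoc_field3 : field3 (fun m => tbr (brackets m)).
Proof. by split=> [m|t x y z]; [exact: B_trilinear|exact: assoc_tbr_smooth]. Qed.

Lemma assoc_ly_triv i : ly_local_triv brackets B (assoc_triv i : local_triv assoc_bundle F).
Proof. by move=> m im; have [/(_ (g (s m) i m))] := phi_smooth. Qed.

Lemma assoc_ly_locally_trivial m :
  exists2 t : local_triv assoc_bundle F, ly_local_triv brackets B t & lt_dom t m.
Proof. by exists (assoc_triv (s m)); [exact: assoc_ly_triv|exact: U_s]. Qed.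

Definition assoc_ly_bundle : ly_bundle M B :=
  @LYBundle R n M F B assoc_bundle brackets assoc_field2 assoc_field3
    assoc_ly_locally_trivial.

(** The i-th inverse after the j-th trivialization is [g i (s m) m] followed by [g (s m) j m] in the
    product, hence [g i j m] by the cocycle identity. *)
Lemma assoc_ly_bundleP : associated_transitions phi U g assoc_ly_bundle.
Proof.
exists assoc_triv; split=> // [i|i j m a im jm]; first exact: assoc_ly_triv.
by rewrite /= phi_trans.
Qed.

End AssociatedBundle.

Theorem theorem3p27 (R : realType) (F : vectType R) (B : ly_brackets F)
    (hB : lie_yamaguti B)
    (k : nat) (G : lie_group R k) (phi : G -> F -> F)
    (hphi : smooth_action B phi)
    (n : nat) (M : manifold R n)
    (I : Type) (U : I -> chart R n M) (hU : countable_atlas U)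
    (g : I -> I -> M -> G) (hg : transition_maps U g) :
  exists xi : ly_bundle M B, associated_transitions phi U g xi.
Proof.
have [_ _ /choice[s U_s]] := hU; have [B2 B3 _ _ _ _ _ _] := hB.
by exists (assoc_ly_bundle B2 B3 hphi hU hg U_s); exact: assoc_ly_bundleP.
Qed.
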